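(* Let $(E,\mathcal F,\mathcal L)$ be an oriented interval greedoid with lattice of flats $\Phi$, and let $A_1>A_2>\dots>A_{k+1}=\hat0$ be a chain in $\Phi$. Then the number of tuples $(\alpha_1,\dots,\alpha_{k+1})$ of elements of $\mathcal L$ with $\alpha_1>\alpha_2>\dots>\alpha_{k+1}$ and $\mathrm{supp}(\alpha_i)=A_i$ for all $i$ equals $$\prod_{i=1}^k\ \sum_{B\in[A_{i+1},A_i]}|\mu_\Phi(B,A_i)|,$$ where $\mu_\Phi$ is the Möbius function of $\Phi$.
   Context: Interval greedoid: a finite set $E$ and a nonempty family $\mathcal F$ of subsets of $E$ (feasible sets) such that for all $X,Y,Z\in\mathcal F$: (IG1) if $X\neq\emptyset$ there is $x\in X$ with $X\setminus\{x\}\in\mathcal F$; (IG2) if $|X|>|Y|$ there is $x\in X\setminus Y$ with $Y\cup\{x\}\in\mathcal F$; (IG3) if $X\subseteq Y\subseteq Z$, $e\in E\setminus Z$, $X\cup\{e\}\in\mathcal F$ and $Z\cup\{e\}\in\mathcal F$, then $Y\cup\{e\}\in\mathcal F$. For $X\in\mathcal F$ let $\Gamma(X)=\{x\in E\setminus X: X\cup\{x\}\in\mathcal F\}$. $X\sim Y$ iff $\Gamma(X)=\Gamma(Y)$; classes $[X]$ are flats; $\Phi$ is the set of flats ordered by $[X]\le[Y]$ iff there is $Z\subseteq E\setminus Y$ with $Y\cup Z\in\mathcal F$ and $Y\cup Z\sim X$; $\Phi$ is a lattice with top $[\emptyset]$ and bottom $\hat0$. For a flat $A=[X]$: $\Gamma(A)=\Gamma(X)$,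 $\xi(A)=\bigcup_{X'\sim X}X'$. For $S\subseteq E$, $\mu(S)=[X]$, $X$ an inclusion-maximal feasible subset of $S$. Join: $A\vee B=\mu(\xi(A)\cap\xi(B))$. A covector is $\alpha:E\to\{0,+,-,1\}$ such that for some flat $A=\mathrm{supp}(\alpha)$, $\alpha\in\{+,-\}$ on $\Gamma(A)$, $\alpha=0$ on $\xi(A)$, $\alpha=1$ elsewhere. Order on symbols: $0<+<1$, $0<-<1$. $\alpha\le\beta$ iff $\mathrm{supp}\,\alpha\le\mathrm{supp}\,\beta$ and they agree on $\Gamma(\mathrm{supp}\,\alpha)\cap\Gamma(\mathrm{supp}\,\beta)$. Product: with $C=\mathrm{supp}\,\alpha\vee\mathrm{supp}\,\beta$, $(\alpha\circ\beta)(e)=\beta(e)$ if $e\in\Gamma(C)\cup\xi(C)$ and $\beta(e)>\alpha(e)$; $\alpha(e)$ if $e\in\Gamma(C)\cup\xi(C)$ otherwise; $1$ if $e\notin\Gamma(C)\cup\xi(C)$. $-\alpha$ swaps $+,-$; $S(\alpha,\beta)=\{e:\alpha(e)=-\beta(e)\in\{+,-\}\}$. Oriented interval greedoid: $(E,\mathcal F,\mathcal L)$ with $\mathcal L$ a set of covectors satisfying (OG1) $\mathrm{supp}:\mathcal L\to\Phi$ surjective; (OG2) $-\mathcal L=\mathcal L$; (OG3) closed under $\circ$; (OG4) if $\alpha,\beta\in\mathcal L$, $x\in S(\alpha,\beta)$, $(\alpha\circ\beta)(x)\ne1$, then some $\gamma\in\mathcal L$ has $\gamma(x)=0$ and $\gamma(y)=(\alpha\circ\beta)(y)=(\beta\circ\alpha)(y)$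 for all $y\notin S(\alpha,\beta)$ with $(\alpha\circ\beta)(y)\neq1$. *)

(* Defs.v *)
From HB Require Import structures.
From mathcomp Require Import all_boot all_order all_algebra.

Set Implicit Arguments.
Unset Strict Implicit.
Unset Printing Implicit Defensive.

(* The symbols 0, +, -, 1. *)
Inductive symbol := SZero | SPlus | SMinus | SOne.

Definition symbol_code (s : symbol) : bool * bool :=
  match s with
  | SZero => (false, false) | SPlus => (true, false)
  | SMinus => (false, true) | SOne => (true, true)
  end.

Definition symbol_decode (c : bool * bool) : symbol :=
  match c with
  | (false, false) => SZero | (true, false) => SPlus
  | (false, true) => SMinus | (true, true) => SOne
  end.

Lemma symbol_codeK : cancel symbol_code symbol_decode.
Proof. by case. Qed.

HB.instance Definition _ := Finite.copy symbol (can_type symbol_codeK).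

Definition symbol_lt (s t : symbol) : bool :=
  match s, t with
  | SZero, SPlus | SZero, SMinus | SZero, SOne => true
  | SPlus, SOne | SMinus, SOne => true
  | _, _ => false
  end.

Definition symbol_opp (s : symbol) : symbol :=
  match s with SPlus => SMinus | SMinus => SPlus | _ => s end.

Definition signed (s : symbol) : bool := s \in [:: SPlus; SMinus].

(* Moebius function of the finite poset (P, le): mu(x, x) = 1 and, for x != y, *)
(* mu(x, y) = - \sum_(x <= z < y) mu(x, z).  The counter n only makes the      *)
(* recursion structural; moebius_rec_eq shows that #|P| steps suffice.         *)
Section Moebius.
Variable T : finType.
Implicit Types (P : {set T}) (le : rel T).

Fixpoint moebius_rec P le (n : nat) (x y : T) : int :=
  if x == y then 1%R else
  if n is m.+1 then
    (- \sum_(z in P | [&& le x z, le z y & z != y]) moebius_rec P le m x z)%R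
  else 0%R.

Definition moebius P le (x y : T) : int := moebius_rec P le #|P| x y.

Lemma moebius_refl P le x : moebius P le x x = 1%R.
Proof. by rewrite /moebius; case: #|P| => [|n] /=; rewrite eqxx. Qed.

Let below P le y := [set z in P | le z y && (z != y)].

Let card_below P le y z :
    {in P & &, transitive le} -> {in P &, antisymmetric le} ->
    y \in P -> z \in below P le y -> #|below P le z| < #|below P le y|.
Proof.
move=> tr asym yP zy; have := zy; rewrite inE => /and3P[zP lezy nzy].
apply: proper_card; apply/properP; split; last first.
  by exists z => //; rewrite inE eqxx !andbF.
apply/subsetP => t; rewrite !inE => /and3P[tP letz ntz].
rewrite tP (tr z) //=; apply: contra ntz => /eqP ety.
by apply/eqP/asym => //; rewrite letz ety lezy.
Qed.

Let moebius_rec_fuel P le n m x y :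
    {in P & &, transitive le} -> {in P &, antisymmetric le} -> y \in P ->
    #|below P le y| <= n -> #|below P le y| <= m ->
  moebius_rec P le n x y = moebius_rec P le m x y.
Proof.
move=> tr asym.
have sum0 k t : #|below P le t| <= 0 ->
    (\sum_(z in P | [&& le x z, le z t & z != t])
        moebius_rec P le k x z = 0)%R.
  rewrite leqn0 cards_eq0 => /eqP b0; rewrite big1 // => z /and4P[zP _ l1 l2].
  by have := in_set0 z; rewrite -b0 inE zP l1 l2.
elim: n m y => [|n IH] [|m] y yP le1 le2 //=; case: eqP => // _.
- by rewrite sum0 // GRing.oppr0.
- by rewrite sum0 // GRing.oppr0.
congr (- _)%R; apply: eq_bigr => z /and4P[zP _ l1 l2].
have lt : #|below P le z| < #|below P le y|.
  by apply: card_below => //; rewrite inE zP l1.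
by apply: IH => //; rewrite -ltnS; apply: leq_trans lt _.
Qed.

Lemma moebius_rec_eq P le x y :
    {in P & &, transitive le} -> {in P &, antisymmetric le} -> y \in P ->
    x != y ->
  moebius P le x y =
    (- \sum_(z in P | [&& le x z, le z y & z != y]) moebius P le x z)%R.
Proof.
move=> tr asym yP nxy.
have P_gt0 : 0 < #|P| by rewrite (cardD1 y) yP.
rewrite {1}/moebius -(prednK P_gt0) /= (negPf nxy).
congr (- _)%R; apply: eq_bigr => z /and4P[zP _ l1 l2].
have lt : #|below P le z| < #|below P le y|.
  by apply: card_below => //; rewrite inE zP l1.
have lt2 : #|below P le y| <= #|P|.
  by apply/subset_leq_card/subsetP => t; rewrite inE => /and3P[].
apply: moebius_rec_fuel => //; last exact: leq_trans (ltnW lt) lt2.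
by rewrite -ltnS (prednK P_gt0); apply: leq_trans lt lt2.
Qed.

End Moebius.

Section OrientedIntervalGreedoid.
Variable E : finType.

(* A flat is the set of feasible sets forming a ~-class. *)
Notation flatT := {set {set E}}.
Notation covT := {ffun E -> symbol}.

Implicit Types (F : {set {set E}}) (X Y Z S : {set E}) (A B C : flatT).
Implicit Types (a b c : covT) (L : {set covT}).

Record interval_greedoid F : Prop := IntervalGreedoid {
  ig_nonempty : F != set0;
  ig_acc : forall X, X \in F -> X != set0 ->
    exists2 x, x \in X & X :\ x \in F;
  ig_exch : forall X Y, X \in F -> Y \in F -> #|Y| < #|X| ->
    exists2 x, x \in X :\: Y & x |: Y \in F;
  ig_interval : forall X Y Z e, X \in F -> Y \in F -> Z \in F ->
    X \subset Y -> Y \subset Z -> e \notin Z ->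
    e |: X \in F -> e |: Z \in F -> e |: Y \in F
}.

Definition Gamma F X : {set E} := [set x in ~: X | x |: X \in F].

Definition flat_of F X : flatT := [set Y in F | Gamma F Y == Gamma F X].

Definition flats F : {set flatT} := [set flat_of F X | X in F].

(* Larger feasible sets lie lower: the class of the empty set is the top.     *)
(* In an interval greedoid the relation does not depend on the choice of the  *)
(* representatives X of A and Y of B.                                         *)
Definition flat_le F A B : bool :=
  [exists X in A, exists Y in B, exists Z : {set E},
     [&& Z \subset ~: Y, Y :|: Z \in F & Gamma F (Y :|: Z) == Gamma F X]].

Definition flat_gt F A B : bool := flat_le F B A && (B != A).

(* All members X of a flat A have the same Gamma F X. *)
Definition Gamma_flat F A : {set E} := \bigcup_(X in A) Gamma F X.

Definition xi A : {set E} := \bigcup_(X in A) X.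

(* The class of an inclusion-maximal feasible subset of S; by exchange it does *)
(* not depend on the one picked.                                              *)
Definition mu F S : flatT :=
  flat_of F (odflt set0
    [pick X | maxset (fun Y : {set E} => (Y \in F) && (Y \subset S)) X]).

Definition join F A B : flatT := mu F (xi A :&: xi B).

Definition covector_on F A a : bool :=
  [forall e, if e \in Gamma_flat F A then signed (a e)
             else if e \in xi A then a e == SZero
             else a e == SOne].

Definition covector F a : bool := [exists A in flats F, covector_on F A a].

(* The default set0 (not a flat) is only reached when a is not a covector. *)
Definition supp F a : flatT :=
  odflt set0 [pick A in flats F | covector_on F A a].

Definition cov_le F a b : bool :=
  flat_le F (supp F a) (supp F b) &&
  [forall e in Gamma_flat F (supp F a) :&: Gamma_flat F (supp F b),
     a e == b e].

Definition cov_gt F a b : bool := cov_le F b a && (b != a).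

Definition cov_opp a : covT := [ffun e => symbol_opp (a e)].

Definition cov_prod F a b : covT :=
  let C := join F (supp F a) (supp F b) in
  [ffun e => if e \in Gamma_flat F C :|: xi C
             then (if symbol_lt (a e) (b e) then b e else a e)
             else SOne].

Definition separation a b : {set E} :=
  [set e | signed (a e) && (a e == symbol_opp (b e))].

Record oriented_interval_greedoid F L : Prop := OrientedIntervalGreedoid {
  oig_greedoid : interval_greedoid F;
  oig_covector : forall a, a \in L -> covector F a;
  oig_surj : forall A, A \in flats F -> exists2 a, a \in L & supp F a = A;
  oig_opp : [set cov_opp a | a in L] = L;
  oig_prod : forall a b, a \in L -> b \in L -> cov_prod F a b \in L;
  oig_elim : forall a b x, a \in L -> b \in L ->
    x \in separation a b -> cov_prod F a b x != SOne ->
    exists2 c, c \in L &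
      c x = SZero /\
      forall y, y \notin separation a b -> cov_prod F a b y != SOne ->
        c y = cov_prod F a b y /\ cov_prod F a b y = cov_prod F b a y
}.

Lemma Gamma_flatE F A X : A \in flats F -> X \in A ->
  Gamma_flat F A = Gamma F X.
Proof.
case/imsetP=> X0 _ -> XA; apply/setP => e; apply/bigcupP/idP; last by exists X.
case=> Y YA; suff -> : Gamma F X = Gamma F Y by [].
by move: XA YA; rewrite !inE => /andP[_ /eqP->] /andP[_ /eqP->].
Qed.

Lemma Gamma_xi F A e : A \in flats F -> e \in Gamma_flat F A -> e \notin xi A.
Proof.
move=> AF eA; apply/negP => /bigcupP[X XA eX].
by move: eA; rewrite (Gamma_flatE AF XA) !inE eX.
Qed.

Lemma suppE F A a : A \in flats F -> covector_on F A a -> supp F a = A.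
Proof.
move=> AF aA; rewrite /supp; case: pickP => [B /andP[BF aB]|/(_ A)] /=; last first.
  by rewrite AF aA.
have GE C : covector_on F C a -> Gamma_flat F C = [set e | signed (a e)].
  move/forallP => h; apply/setP => e; have := h e; rewrite inE.
  by case: (e \in Gamma_flat F C); case: (e \in xi C) => // /eqP->.
have : Gamma_flat F A = Gamma_flat F B by rewrite !GE.
move: (AF) (BF) => /imsetP[X XF AE] /imsetP[Y YF BE].
have XA : X \in A by rewrite AE inE XF eqxx.
have YB : Y \in B by rewrite BE inE YF eqxx.
by rewrite (Gamma_flatE AF XA) (Gamma_flatE BF YB) AE BE /flat_of => ->.
Qed.

End OrientedIntervalGreedoid.

(* Main.v *)
Require Import Defs.
From mathcomp Require Import all_boot all_order all_algebra.

(** Flats are ordered by reverse inclusion of the sets [xi A]. Fix a covector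
    [a] of [L] with support [A0] and, for a flat [A >= A0] and a subset [S] of
    [Gamma A :&: xi A0], let [N A S] be the number of restrictions to [S] of the
    covectors [b >= a] of [L] with support [A]. For [e] in
    [Gamma A :&: xi A0], let [A + e] be the flat of the sets [e |: X], [X] in [A].
    A restriction to [S] extends to [e |: S] with both signs exactly when it
    comes from a covector with support [A + e] (elimination one way, products the
    other way), and this is impossible if [S] meets [xi (A + e)]. Hence
      [N A (e |: S) = N A S + (S disjoint from xi (A + e)) * N (A + e) S].
    The integer functions [f A S] on flats determined by
      [\sum_(C <= B <= A) f A S B = (S disjoint from xi C)]  for all [C <= A]
    obey the same recursion with a minus sign, so they alternate in sign with the
    rank and the sum of their absolute values is [N A S]. When
    [S = Gamma A :&: xi A0] the right-hand side is [C == A], so [f A S B] is the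
    Moebius function [mu(B, A)], while a covector [b >= a] is determined by its
    restriction to [S]. The chain is then counted from its bottom, where the
    covector is unique. *)

Set Implicit Arguments.
Unset Strict Implicit.
Unset Printing Implicit Defensive.

(** * Möbius inversion in a finite poset *)

Section MoebiusInversion.

Variables (T : finType) (P : {set T}) (le : rel T).
Hypothesis le_refl : {in P, reflexive le}.
Hypothesis le_trans : {in P & &, transitive le}.
Hypothesis le_anti : {in P &, antisymmetric le}.

Lemma sum_moebius x y : x \in P -> y \in P -> le x y ->
  (\sum_(z in P | le x z && le z y) moebius P le x z = (x == y)%:R :> int)%R.
Proof.
move=> xP yP lexy; have [<-|nexy] := eqVneq x y.
  rewrite (big_pred1 x) ?moebius_refl // => z.
  apply/idP/eqP => [/and3P[zP xz zx]|->]; last by rewrite xP le_refl.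
  by apply: le_anti => //; rewrite zx xz.
rewrite (bigD1 y) /=; last by rewrite yP lexy le_refl.
rewrite (moebius_rec_eq le_trans le_anti yP nexy); apply/eqP.
rewrite GRing.addrC GRing.subr_eq0; apply/eqP/eq_bigl => z.
by rewrite -!andbA.
Qed.

(** Write [f x] as the sum of [f z * (x == z)] and expand the indicator by [sum_moebius]; after
    exchanging the sums, the inner sum over [z] is given by the hypothesis. *)
Lemma moebius_unique (f : T -> int) x y : x \in P -> y \in P -> le x y ->
  {in P, forall c, le x c -> le c y ->
    (\sum_(z in P | le c z && le z y) f z = (c == y)%:R)%R} ->
  f x = moebius P le x y.
Proof.
move=> xP yP lexy fE.
transitivity (\sum_(z in P | le x z && le z y) f z * (x == z)%:R)%R.
  rewrite (bigD1 x) /=; last by rewrite xP le_refl ?lexy.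
  rewrite eqxx GRing.mulr1 big1 ?GRing.addr0 // => z /andP[_ nzx].
  by rewrite eq_sym (negPf nzx) GRing.mulr0.
transitivity (\sum_(z in P | le x z && le z y)
    \sum_(c in P | le x c && le c z) f z * moebius P le x c)%R.
  apply: eq_bigr => z /and3P[zP xz zy].
  by rewrite -sum_moebius // GRing.mulr_sumr.
rewrite (exchange_big_dep (fun c => [&& c \in P, le x c & le c y])) /=; last first.
  move=> z c /and3P[zP xz zy] /and3P[cP xc cz].
  by rewrite cP xc (le_trans zP cP yP).
transitivity (\sum_(c in P | le x c && le c y) (c == y)%:R * moebius P le x c)%R.
  apply: eq_bigr => c /and3P[cP xc cy].
  rewrite -fE // GRing.mulr_suml; apply: eq_bigl => z.
  apply/idP/idP; first by case/andP=> /and3P[-> _ ->] /and3P[_ _ ->].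
  case/and3P=> zP cz zy; rewrite zP zy cP xc cz.
  by rewrite (le_trans cP xP zP).
rewrite (bigD1 y) /=; last by rewrite yP lexy le_refl.
rewrite eqxx GRing.mul1r big1 ?GRing.addr0 // => c /andP[_ ncy].
by rewrite (negPf ncy) GRing.mul0r.
Qed.

End MoebiusInversion.

(** * Flats of an interval greedoid *)

Section Greedoid.

Variables (E : finType) (F : {set {set E}}).
Hypothesis gF : interval_greedoid F.

Implicit Types (X Y Z W S : {set E}) (A B C : {set {set E}}).

Lemma in_Gamma x X : (x \in Gamma F X) = (x \notin X) && (x |: X \in F).
Proof. by rewrite !inE. Qed.

Lemma exchange_Gamma X Y : X \in F -> Y \in F -> #|Y| < #|X| ->
  exists2 x, x \in X & x \in Gamma F Y.
Proof.
move=> XF YF /(ig_exch gF XF YF)[x /setDP[xX xY] xYF].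
by exists x; rewrite // in_Gamma xY.
Qed.

Lemma set0_feasible : set0 \in F.
Proof.
have [X] := set0Pn _ (ig_nonempty gF).
have [n] := ubnP #|X|; elim: n X => // n IH X; rewrite ltnS => leXn XF.
have [<-//|/(ig_acc gF XF)[x xX]] := eqVneq X set0.
by apply: IH; rewrite (cardsD1 x) xX in leXn.
Qed.

Lemma augment X Y n : X \in F -> Y \in F -> #|Y| <= n <= #|X| ->
  exists W, [/\ W \in F, Y \subset W, W \subset Y :|: X & #|W| = n].
Proof.
move=> XF YF; elim: n => [|n IH] /andP[leYn lenX].
  by exists Y; rewrite subxx subsetUl; split=> //; apply/eqP; rewrite -leqn0.
move: leYn; rewrite leq_eqVlt => /predU1P[<-|leYn].
  by exists Y; rewrite subxx subsetUl.
have [|W [WF YW WU cW]] := IH; first by rewrite -ltnS leYn ltnW.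
have [|x xX] := exchange_Gamma XF WF; first by rewrite cW.
rewrite in_Gamma => /andP[xW xWF]; exists (x |: W); split=> //.
- exact: subset_trans YW (subsetUr _ _).
- by rewrite subUset WU andbT sub1set inE xX orbT.
- by rewrite cardsU1 xW cW.
Qed.

(* "Gamma F X disjoint from S" says that X cannot be augmented within S. *)
Lemma spanning_card S X Y : X \in F -> Y \in F -> Y \subset S ->
  [disjoint Gamma F X & S] -> #|Y| <= #|X|.
Proof.
move=> XF YF YS dX; rewrite leqNgt; apply/negP => /(exchange_Gamma YF XF)[y yY].
by move/(disjointFr dX); rewrite (subsetP YS).
Qed.

(** If [z] extends [U], exchange takes an element of [z |: U] that extends [V]; it is not in [U],
    which lies in [S], so it is [z]. *)
Lemma spanning_Gamma S X Y : X \in F -> Y \in F -> X \subset S -> Y \subset S ->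
  [disjoint Gamma F X & S] -> [disjoint Gamma F Y & S] -> Gamma F X = Gamma F Y.
Proof.
have sub U V : U \in F -> V \in F -> U \subset S -> V \subset S ->
  [disjoint Gamma F U & S] -> [disjoint Gamma F V & S] ->
  Gamma F U \subset Gamma F V.
- move=> UF VF US VS dU dV; apply/subsetP => z; rewrite in_Gamma => /andP[zU zUF].
  have [|w] := exchange_Gamma zUF VF.
    by rewrite cardsU1 zU ltnS; apply: spanning_card dU.
  rewrite in_setU1 => /predU1P[->//|wU] /(disjointFr dV).
  by rewrite (subsetP US).
by move=> *; apply/eqP; rewrite eqEsubset !sub.
Qed.

Lemma flat_of_in_flats X : X \in F -> flat_of F X \in flats F.
Proof. exact: imset_f. Qed.

Lemma in_flat_of X : X \in F -> X \in flat_of F X.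
Proof. by move=> XF; rewrite inE XF eqxx. Qed.

Lemma eq_flat_of X Y : Gamma F X = Gamma F Y -> flat_of F X = flat_of F Y.
Proof. by rewrite /flat_of => ->. Qed.

Lemma in_flat A X : A \in flats F -> X \in A -> X \in F /\ A = flat_of F X.
Proof.
by case/imsetP=> Y YF ->; rewrite inE => /andP[XF /eqP eXY]; rewrite (eq_flat_of eXY).
Qed.

Lemma flat_mem A : A \in flats F -> exists X, X \in A.
Proof. by case/imsetP=> X XF ->; exists X; apply: in_flat_of. Qed.

Lemma in_flatE A X Y : A \in flats F -> X \in A -> Y \in F ->
  Gamma F Y = Gamma F X -> Y \in A.
Proof.
move=> AF XA YF eYX; have [_ ->] := in_flat AF XA.
by rewrite inE YF eYX eqxx.
Qed.

Lemma sub_xi A X : X \in A -> X \subset xi A.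
Proof. exact: bigcup_sup. Qed.

Lemma disjoint_Gamma_xi A X : A \in flats F -> X \in A ->
  [disjoint Gamma F X & xi A].
Proof.
move=> AF XA; rewrite -(Gamma_flatE AF XA) disjoint_subset.
by apply/subsetP => e /(Gamma_xi AF).
Qed.

(** Exchange with a member of [A] enlarges [X] inside [xi A] to the size of that member. No larger
    feasible set fits there, so both span [xi A] and have the same [Gamma]. *)
Lemma extend_in_flat A X : A \in flats F -> X \in F -> X \subset xi A ->
  exists2 W, W \in A & X \subset W.
Proof.
move=> AF XF XA; have [Y YA] := flat_mem AF; have [YF _] := in_flat AF YA.
have dY := disjoint_Gamma_xi AF YA.
have leXY : #|X| <= #|Y| by apply: spanning_card dY.
have [|W [WF XW WU cW]] := @augment Y X #|Y| YF XF; first by rewrite leXY /=.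
exists W => //; have WA : W \subset xi A.
  by apply: subset_trans WU _; rewrite subUset XA sub_xi.
apply: (in_flatE AF YA WF).
apply: (@spanning_Gamma (xi A)) => //; first exact: sub_xi.
rewrite disjoint_subset; apply/subsetP => z; rewrite in_Gamma => /andP[zW zWF].
apply/negP => /= zA; suff : #|z |: W| <= #|Y| by rewrite cardsU1 zW cW ltnn.
by apply: spanning_card dY => //; rewrite subUset sub1set zA.
Qed.

Lemma flat_card A X Y : A \in flats F -> X \in A -> Y \in A -> #|X| = #|Y|.
Proof.
move=> AF XA YA; have [XF _] := in_flat AF XA; have [YF _] := in_flat AF YA.
by apply/eqP; rewrite eqn_leq !(@spanning_card (xi A)) ?sub_xi ?disjoint_Gamma_xi.
Qed.

Lemma in_flat_card A X Y : A \in flats F -> Y \in A -> X \in F ->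
  X \subset xi A -> #|X| = #|Y| -> X \in A.
Proof.
move=> AF YA XF XA cX; have [W WA XW] := extend_in_flat AF XF XA.
suff -> : X = W by [].
by apply/eqP; rewrite eqEcard XW (flat_card AF WA YA) cX /=.
Qed.

Lemma mu_spanning S X : X \in F -> X \subset S -> [disjoint Gamma F X & S] ->
  mu F S = flat_of F X.
Proof.
move=> XF XS dX; rewrite /mu; case: pickP => [Y /maxsetP[/andP[YF YS] maxY]|no] /=.
  apply/eq_flat_of/(@spanning_Gamma S) => //.
  rewrite disjoint_subset; apply/subsetP => z; rewrite in_Gamma => /andP[zY zYF].
  apply/negP => /= zS; have := maxY (z |: Y); rewrite zYF subUset sub1set zS YS.
  by move/(_ isT (subsetUr _ _)) => eY; rewrite -eY setU11 in zY.
have [|W mW _] := @maxset_exists _ (fun Y => (Y \in F) && (Y \subset S)) X.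
  by rewrite XF.
by have := no W; rewrite mW.
Qed.

Lemma mu_xi A : A \in flats F -> mu F (xi A) = A.
Proof.
move=> AF; have [X XA] := flat_mem AF; have [XF eA] := in_flat AF XA.
by rewrite {2}eA; apply: mu_spanning; rewrite ?sub_xi ?disjoint_Gamma_xi.
Qed.

Lemma xi_inj : {in flats F &, injective (@xi E)}.
Proof. by move=> A B AF BF eAB; rewrite -(mu_xi AF) eAB mu_xi. Qed.

(* A member W of A is transformed into Y by single exchanges that enlarge a     *)
(* feasible set V contained in both.  If f enters and W becomes U, then f |: V *)
(* is feasible while f |: W is not, so by (IG3) neither is f |: (z |: W); this *)
(* excludes the unwanted exchanges between z |: W and z |: U.                  *)
Lemma Gamma_step A X Y z : A \in flats F -> X \in A -> Y \in A ->
  z \in Gamma F X -> Gamma F (z |: X) = Gamma F (z |: Y).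
Proof.
move=> AF XA YA zX.
have zA W : W \in A -> (z \notin W) && (z |: W \in F).
  by move=> WA; rewrite -in_Gamma -(Gamma_flatE AF WA) (Gamma_flatE AF XA).
have AsubF W : W \in A -> W \in F by move=> WA; case: (in_flat AF WA).
(* Induction on the number of elements of [Y] missing from [V], with [W] varying in [A]; it starts
   from [V = set0]. *)
suff H n (V W : {set E}) : #|Y| - #|V| < n -> V \in F -> V \subset Y -> W \in A ->
    V \subset W -> Gamma F (z |: W) = Gamma F (z |: Y).
  by apply: (H #|Y|.+1 set0); rewrite ?sub0set ?set0_feasible // ltnS leq_subr.
elim: n V W => // n IH V W leVn VF VY WA VW.
have cWY := flat_card AF WA YA.
case: (ltnP #|V| #|Y|) => [ltVY|leYV]; last first.
  have eVY : V = Y by apply/eqP; rewrite eqEcard VY.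
  suff -> : W = Y by [].
  by apply/esym/eqP; rewrite eqEcard -{1}eVY VW cWY /=.
have [f fY] := exchange_Gamma (AsubF _ YA) VF ltVY.
move=> fV; have := fV; rewrite in_Gamma => /andP[fnV fVF].
have ltfV : #|Y| - #|f |: V| < n.
  by rewrite cardsU1 fnV -ltnS (leq_trans _ leVn) // ltnS ltn_sub2l.
have fVY : f |: V \subset Y by rewrite subUset sub1set fY.
case: (boolP (f \in W)) => fW.
  by apply: (IH (f |: V)) => //; rewrite subUset sub1set fW.
(* [U] lies between [f |: V] and [f |: W] and has the size of [W], so it is [f |: W] less one
   element of [W]. *)
have [|U [UF fVU UfW cU]] := @augment W (f |: V) #|W| (AsubF _ WA) fVF.
  by rewrite leqnn andbT cWY cardsU1 fnV.
have fA : f \in xi A by apply: (subsetP (sub_xi YA)).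
have UW : U \subset f |: W.
  apply: subset_trans UfW _; rewrite subUset subsetUr andbT.
  by rewrite setUS.
have UA : U \in A.
  apply: (in_flat_card AF WA) => //; apply: subset_trans UW _.
  by rewrite subUset sub1set fA sub_xi.
rewrite -(IH (f |: V) U) //.
have [zW zWF] := andP (zA _ WA); have [zU zUF] := andP (zA _ UA).
have fz : f != z.
  by apply: contraTneq fA => ->; rewrite (disjointFr (disjoint_Gamma_xi AF XA)).
have fGW : f \notin Gamma F W.
  by apply/negP => /(disjointFr (disjoint_Gamma_xi AF WA)); rewrite fA.
have nzfW : z |: (f |: W) \notin F.
  apply: contra fGW => zfW; rewrite in_Gamma fW /=.
  apply: (@ig_interval _ _ gF V W (z |: W)); rewrite ?subsetUr //.
  - exact: AsubF.
  - by rewrite in_setU1 negb_or fz.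
  - by rewrite setUCA.
(* For either inclusion, exchange yields [w] itself or an element completing [z |: U] or [z |: W] to
   [z |: (f |: W)], which [nzfW] forbids. *)
apply/eqP; rewrite eqEsubset; apply/andP; split; apply/subsetP => w.
  rewrite in_Gamma => /andP[wW wWF].
  have [|u uW uU] := exchange_Gamma wWF zUF.
    by rewrite (cardsU1 w) wW !cardsU1 zW zU cU.
  move: uW; rewrite in_setU1 => /predU1P[<-//|].
  move: uU; rewrite in_Gamma in_setU1 negb_or -andbA.
  case/and3P=> uz unU uzU; rewrite in_setU1 (negPf uz) /= => uW.
  case/negP: nzfW; suff <- : u |: U = f |: W by rewrite setUCA.
  apply/eqP; rewrite eqEcard subUset sub1set in_setU1 uW orbT UW /=.
  by rewrite !cardsU1 fW unU cU.
rewrite in_Gamma => /andP[wU wUF].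
have [|u uU uW] := exchange_Gamma wUF zWF.
  by rewrite (cardsU1 w) wU !cardsU1 zW zU cU.
move: uU; rewrite in_setU1 => /predU1P[<-//|].
move: uW; rewrite in_Gamma in_setU1 negb_or -andbA.
case/and3P=> uz unW uzW; rewrite in_setU1 (negPf uz) /= => /(subsetP UW).
rewrite in_setU1 (negPf unW) orbF => /eqP uf.
by case/negP: nzfW; rewrite setUCA -uf.
Qed.

(** The elements of [W :\: X] are added one at a time in a feasible order; by [Gamma_step] the sets
    grown from [X] and from [Y] stay in a common flat. *)
Lemma flat_extension A X Y W : A \in flats F -> X \in A -> Y \in A -> W \in F ->
  X \subset W -> Y :|: W :\: X \in flat_of F W.
Proof.
have [n] := ubnP (#|W| - #|X|); elim: n A X Y => // n IH A X Y; rewrite ltnS.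
move=> leWn AF XA YA WF XW; have [XF eA] := in_flat AF XA.
case: (ltnP #|X| #|W|) => [ltXW|leWX]; last first.
  have -> : W = X by apply/esym/eqP; rewrite eqEcard XW.
  by rewrite setDv setU0 -eA.
have [z zW zX] := exchange_Gamma WF XF ltXW; have := zX.
rewrite in_Gamma => /andP[nzX zXF].
have nzA : z \in Gamma F Y.
  by rewrite -(Gamma_flatE AF YA) (Gamma_flatE AF XA).
have zYF : z |: Y \in F by move: nzA; rewrite in_Gamma => /andP[].
have -> : Y :|: W :\: X = z |: Y :|: W :\: (z |: X).
  apply/setP => t; rewrite !inE negb_or.
  by case: eqP => [->|]; rewrite ?zW ?nzX ?orbT.
apply: (IH (flat_of F (z |: X))) => //.
- by apply: leq_trans leWn; apply: ltn_sub2l; rewrite // cardsU1 nzX.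
- exact: flat_of_in_flats.
- exact: in_flat_of.
- by rewrite inE zYF (Gamma_step AF YA XA) /=.
- by rewrite subUset sub1set zW.
Qed.

(** * The order of flats as reverse inclusion *)

Lemma flat_le_sub A B X Y : A \in flats F -> X \in A -> Y \in B ->
  Y \subset X -> flat_le F A B.
Proof.
move=> AF XA YB YX; have [XF _] := in_flat AF XA.
apply/exists_inP; exists X => //; apply/exists_inP; exists Y => //.
apply/existsP; exists (X :\: Y); rewrite setDE subsetIr.
by rewrite setUIr setUCr setIT (setUidPr YX) XF eqxx.
Qed.

(** If [Y :|: Z] is in [A], then by [flat_extension] every member of [B] completed by the same
    elements is in [A]. Conversely, a member of [B] inside [xi A] grows into a member of [A]. *)
Lemma flat_leE A B : A \in flats F -> B \in flats F ->
  flat_le F A B = (xi B \subset xi A).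
Proof.
move=> AF BF; apply/idP/idP.
  case/exists_inP=> X XA /exists_inP[Y YB /existsP[Z /and3P[ZY YZF /eqP eG]]].
  have YZA := in_flatE AF XA YZF eG.
  apply/bigcupsP => Y' Y'B.
  have := flat_extension BF YB Y'B YZF (subsetUl _ _).
  have [_ <-] := in_flat AF YZA => /sub_xi.
  by apply: subset_trans; apply: subsetUl.
move=> BA; have [Y YB] := flat_mem BF; have [YF _] := in_flat BF YB.
have [|W WA YW] := extend_in_flat AF YF; first exact: subset_trans (sub_xi YB) BA.
exact: flat_le_sub WA YB YW.
Qed.

Lemma flat_le_refl A : A \in flats F -> flat_le F A A.
Proof. by move=> AF; rewrite flat_leE. Qed.

Lemma flat_le_trans : {in flats F & &, transitive (flat_le F)}.
Proof.
by move=> B A C BF AF CF; rewrite !flat_leE // => AB BC; apply: subset_trans BC AB.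
Qed.

Lemma flat_le_anti : {in flats F &, antisymmetric (flat_le F)}.
Proof.
by move=> A B AF BF; rewrite !flat_leE // -eqEsubset => /eqP/xi_inj ->.
Qed.

(* The flat written A + e above; it does not depend on the picked X when e is *)
(* in Gamma A.                                                                 *)
Definition flat_add e A : {set {set E}} :=
  flat_of F (e |: odflt set0 [pick X in A]).

Lemma flat_addE e A X : A \in flats F -> X \in A -> e \in Gamma_flat F A ->
  flat_add e A = flat_of F (e |: X).
Proof.
move=> AF XA; rewrite /flat_add; case: pickP => [Y YA|/(_ X)]; last by rewrite XA.
by rewrite (Gamma_flatE AF YA) => eY; apply/eq_flat_of/(Gamma_step AF).
Qed.

(** * Adding one element to a flat *)

Section FlatAdd.

Variables (A C : {set {set E}}) (e : E).
Hypotheses (AF : A \in flats F) (CF : C \in flats F).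
Hypothesis eA : e \in Gamma_flat F A.

Lemma flat_add_mem X : X \in A -> e |: X \in flat_add e A.
Proof.
move=> XA; rewrite (flat_addE AF XA eA); apply: in_flat_of.
by move: eA; rewrite (Gamma_flatE AF XA) in_Gamma => /andP[].
Qed.

Lemma flat_add_flat : flat_add e A \in flats F.
Proof.
have [X XA] := flat_mem AF; rewrite (flat_addE AF XA eA); apply: flat_of_in_flats.
by move: eA; rewrite (Gamma_flatE AF XA) in_Gamma => /andP[].
Qed.

(** If [xi C] contains [e] and [xi A], the feasible set [e |: X] grows into a member of [C]. So
    [A + e] is the largest flat below [A] with [e] in its [xi], which is how intervals split in the
    recursion. *)
Lemma flat_add_le : flat_le F C (flat_add e A) = flat_le F C A && (e \in xi C).
Proof.
have [X XA] := flat_mem AF; have eXA := flat_add_mem XA.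
have addF := flat_add_flat; rewrite !flat_leE //.
apply/idP/andP=> [le|[le eC]].
  split; last by apply/(subsetP le)/(subsetP (sub_xi eXA)); rewrite setU11.
  apply: subset_trans le; rewrite -flat_leE //.
  exact: flat_le_sub eXA XA (subsetUr _ _).
have [eXF _] := in_flat addF eXA.
have [|W WC eXW] := extend_in_flat CF eXF.
  by rewrite subUset sub1set eC (subset_trans (sub_xi XA)).
rewrite -flat_leE //; exact: flat_le_sub WC eXA eXW.
Qed.

End FlatAdd.

Lemma flat_add_le_self A e : A \in flats F -> e \in Gamma_flat F A ->
  flat_le F (flat_add e A) A.
Proof.
move=> AF eA; have addF := flat_add_flat AF eA.
by have := flat_add_le AF addF eA; rewrite flat_le_refl // => /esym/andP[].
Qed.

Lemma mem_xi_flat_add A e : A \in flats F -> e \in Gamma_flat F A ->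
  e \in xi (flat_add e A).
Proof.
move=> AF eA; have addF := flat_add_flat AF eA.
by have := flat_add_le AF addF eA; rewrite flat_le_refl // => /esym/andP[].
Qed.

(** Consequently a covector with support [C] never takes the value 1 on [Gamma A]. When [W] is
    larger than [X], replacing one element of [W] by [e] gives a feasible [U]; as [e] is not in
    [xi C], [Gamma F U] and [Gamma F W] differ, and exchange at an element of the difference makes
    [e |: W] feasible. *)
Lemma Gamma_flat_lower A C : A \in flats F -> C \in flats F -> flat_le F C A ->
  Gamma_flat F A \subset Gamma_flat F C :|: xi C.
Proof.
move=> AF CF leCA; apply/subsetP => e eA; rewrite in_setU orbC.
case: (boolP (e \in xi C)) => //= eC.
have [X XA] := flat_mem AF; have [XF _] := in_flat AF XA.
move: leCA; rewrite flat_leE // => sAC; have [|W WC XW] := extend_in_flat CF XF.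
  exact: subset_trans (sub_xi XA) sAC.
have [WF _] := in_flat CF WC; rewrite (Gamma_flatE CF WC).
case: (eqVneq X W) => [<-|neXW]; first by rewrite -(Gamma_flatE AF XA).
have eX : e \notin X by apply: contra eC => /(subsetP XW)/(subsetP (sub_xi WC)).
have eW : e \notin W by apply: contra eC => /(subsetP (sub_xi WC)).
have eXF : e |: X \in F.
  by move: eA; rewrite (Gamma_flatE AF XA) in_Gamma => /andP[].
have ltXW : #|X| < #|W| by rewrite proper_card // properEneq neXW.
have [|U [UF eXU UeXW cU]] := @augment W (e |: X) #|W| WF eXF.
  by rewrite cardsU1 eX leqnn andbT.
have sUW : U \subset e |: W.
  by apply: subset_trans UeXW _; rewrite subUset subsetUr setUS.
have eU : e \in U by apply: (subsetP eXU); rewrite setU11.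
have addW u : u \in W -> u \notin U -> u |: U = e |: W.
  move=> uW uU; apply/eqP; rewrite eqEcard subUset sub1set in_setU1 uW orbT sUW /=.
  by rewrite !cardsU1 uU eW cU.
case: (eqVneq (Gamma F U) (Gamma F W)) => [eUW|].
  case/negP: eC; apply: (subsetP (sub_xi _)) eU.
  exact: in_flatE CF WC UF eUW.
rewrite eqEsubset negb_and => /orP[] /subsetPn[w].
  rewrite !in_Gamma => /andP[wU wUF] nw; rewrite eW /=.
  have [|u uU] := exchange_Gamma wUF WF; first by rewrite cardsU1 wU cU.
  have nwW : w \notin Gamma F W by rewrite in_Gamma.
  move=> uW; have uw : u != w by apply: contraNneq nwW => <-.
  move: uU; rewrite in_setU1 (negPf uw) /= => /(subsetP sUW).
  have := uW; rewrite in_Gamma => /andP[nuW uWF]; rewrite in_setU1 (negPf nuW) orbF.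
  by move/eqP=> <-.
rewrite !in_Gamma => /andP[wW wWF] nw; rewrite eW /=.
have [|u uW] := exchange_Gamma wWF UF; first by rewrite cardsU1 wW cU.
have nwU : w \notin Gamma F U by rewrite in_Gamma.
move=> uU; have uw : u != w by apply: contraNneq nwU => <-.
move: uW; rewrite in_setU1 (negPf uw) /= => uW.
by move: uU; rewrite in_Gamma => /andP[nuU]; rewrite addW.
Qed.

Lemma flat_lt_Gamma A C : A \in flats F -> C \in flats F -> flat_le F C A ->
  C != A -> exists2 e, e \in Gamma_flat F A & e \in xi C.
Proof.
move=> AF CF leCA neCA; have [X XA] := flat_mem AF; have [XF eA] := in_flat AF XA.
move: leCA; rewrite flat_leE // => sAC; have [|W WC XW] := extend_in_flat CF XF.
  exact: subset_trans (sub_xi XA) sAC.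
have [WF eC] := in_flat CF WC.
case: (ltnP #|X| #|W|) => [ltXW|leWX]; last first.
  by case/eqP: neCA; rewrite eA eC; congr flat_of; apply/esym/eqP; rewrite eqEcard XW.
have [e eW eX] := exchange_Gamma WF XF ltXW.
by exists e; [rewrite (Gamma_flatE AF XA)|apply: (subsetP (sub_xi WC))].
Qed.

(** All members of a flat have the same size, so the maximum is that common size. *)
Definition flat_rank A : nat := \max_(X in A) #|X|.

Lemma flat_rankE A X : A \in flats F -> X \in A -> flat_rank A = #|X|.
Proof.
move=> AF XA; rewrite /flat_rank (eq_bigr (fun=> #|X|)) => [|Y YA]; last first.
  exact: flat_card AF YA XA.
apply/eqP; rewrite eqn_leq (@leq_bigmax_cond _ (mem A) (fun=> #|X|) X XA) andbT.
exact/bigmax_leqP.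
Qed.

Lemma flat_rank_add A e : A \in flats F -> e \in Gamma_flat F A ->
  flat_rank (flat_add e A) = (flat_rank A).+1.
Proof.
move=> AF eA; have [X XA] := flat_mem AF.
rewrite (flat_rankE (flat_add_flat AF eA) (flat_add_mem AF eA XA)).
rewrite (flat_rankE AF XA) cardsU1.
by move: eA; rewrite (Gamma_flatE AF XA) in_Gamma => /andP[->].
Qed.

(** * Alternating solutions of the deletion-contraction recursion *)

Section DeletionContraction.

Variables (A0 : {set {set E}}) (N : {set {set E}} -> {set E} -> nat).
Hypothesis A0F : A0 \in flats F.
Hypothesis N0 : forall A, A \in flats F -> flat_le F A0 A -> N A set0 = 1.
Hypothesis NU1 : forall A S e, A \in flats F -> flat_le F A0 A ->
  S \subset Gamma_flat F A :&: xi A0 -> e \in Gamma_flat F A :&: xi A0 ->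
  e \notin S ->
  N A (e |: S) =
    N A S + [disjoint S & xi (flat_add e A)] * N (flat_add e A) S.

Let sgn A : int := ((-1) ^+ flat_rank A)%R.

(** The function [f A S] is encoded as [sgn A * sgn B * g B] with [g] natural, which builds in the
    alternation of signs. Induction on the size of [S]: unless [S :\ e] meets [xi (A + e)], the
    function for [A + e] is added to [g] below [A + e]. *)
Lemma moebius_expansion A S : A \in flats F -> flat_le F A0 A ->
    S \subset Gamma_flat F A :&: xi A0 ->
  exists g : {set {set E}} -> nat,
    (forall C, C \in flats F -> flat_le F C A ->
      (\sum_(B in flats F | flat_le F C B && flat_le F B A) sgn B * (g B)%:R
        = sgn A * [disjoint S & xi C]%:R)%R) /\
    \sum_(B in flats F | flat_le F A0 B && flat_le F B A) g B = N A S.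
Proof.
have [n] := ubnP #|S|; elim: n A S => // n IH A S; rewrite ltnS => leSn AF A0A SA.
have [->|[e eS]] := set_0Vmem S.
  have pick1 (R : nmodType) (f : {set {set E}} -> R) C :
    flat_le F C A -> (forall B, B != A -> f B = 0%R) ->
    (\sum_(B in flats F | flat_le F C B && flat_le F B A) f B = f A)%R.
  - move=> CA f0; rewrite (bigD1 A) /= ?AF ?CA ?flat_le_refl // big1 ?GRing.addr0 //.
    by move=> B /andP[_ /f0].
  exists (fun B => (B == A) : nat); split=> [C CF CA|].
    rewrite pick1 // => [|B /negPf->]; last by rewrite GRing.mulr0.
    by rewrite eqxx disjoints_subset sub0set.
  rewrite N0 //; have := pick1 nat (fun B => (B == A) : nat) A0 A0A.
  by rewrite eqxx => -> // B /negPf->.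
pose S' := S :\ e; have eS' : e \notin S' by rewrite !inE eqxx.
have cS' : #|S'| < n by rewrite (cardsD1 e) eS in leSn.
have eA : e \in Gamma_flat F A :&: xi A0 by apply: (subsetP SA).
have S'A : S' \subset Gamma_flat F A :&: xi A0.
  by apply: subset_trans SA; apply: subsetDl.
have ES : S = e |: S' by rewrite setD1K.
have [g [gM gN]] := IH A S' cS' AF A0A S'A.
have [eGA eA0] := setIP eA.
have AeF := flat_add_flat AF eGA.
have A0Ae : flat_le F A0 (flat_add e A) by rewrite flat_add_le // A0A.
have disjE C : C \in flats F -> flat_le F C A ->
  [disjoint S & xi C] = (e \notin xi C) && [disjoint S' & xi C].
- by move=> CF CA; rewrite ES !disjoints_subset subUset sub1set inE.
(* If [S'] meets [xi (A + e)], it meets [xi C] for every [C] below [A + e], so the same [g]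
   serves. *)
rewrite {2}ES NU1 //; case: (boolP [disjoint S' & _]) => dS'; last first.
  exists g; split; last by rewrite gN addn0.
  move=> C CF CA; rewrite gM // disjE //.
  case: (boolP (e \in xi C)) => //= eC.
  suff /negbTE-> : ~~ [disjoint S' & xi C] by [].
  have CAe : flat_le F C (flat_add e A) by rewrite flat_add_le // CA.
  apply: contra dS'; rewrite !disjoint_subset => /subset_trans; apply.
  apply/subsetP => t; rewrite !inE; apply: contra; apply: subsetP.
  by rewrite -flat_leE.
have S'Ae : S' \subset Gamma_flat F (flat_add e A) :&: xi A0.
  apply/subsetP => s sS'; have /setIP[sA sA0] := subsetP S'A _ sS'.
  rewrite inE sA0 andbT.
  have := subsetP (Gamma_flat_lower AF AeF (flat_add_le_self AF eGA)) _ sA.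
  by rewrite in_setU (disjointFr dS' sS') orbF.
have [h [hM hN]] := IH _ S' cS' AeF A0Ae S'Ae.
exists (fun B => g B + flat_le F B (flat_add e A) * h B); split; last first.
  rewrite big_split /= gN mul1n; congr addn.
  rewrite -hN big_mkcond [RHS]big_mkcond; apply: eq_bigr => B _.
  case: (boolP (B \in flats F)) => //= BF.
  by rewrite (flat_add_le AF BF eGA); case: flat_le; case: flat_le; case: (e \in _);
    rewrite ?mul1n ?mul0n.
move=> C CF CA.
transitivity (sgn A * [disjoint S' & xi C]%:R +
  \sum_(B in flats F | flat_le F C B && flat_le F B (flat_add e A)) sgn B * (h B)%:R)%R.
  rewrite -gM // [X in (_ + X)%R]big_mkcond [X in (X + _)%R]big_mkcond.
  rewrite -big_split [LHS]big_mkcond; apply: eq_bigr => B _.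
  case: (boolP (B \in flats F)) => /= BF; last by rewrite GRing.addr0.
  rewrite (flat_add_le AF BF eGA).
  case: flat_le; case: flat_le; case: (e \in _); rewrite /= ?GRing.addr0 //.
    by rewrite mul1n GRing.natrD GRing.mulrDr.
  by rewrite mul0n addn0.
(* If [e] is in [xi C], the ranks of [A] and [A + e] differ by one and the two terms cancel;
   otherwise no flat lies between [C] and [A + e]. *)
rewrite disjE //; case: (boolP (e \in xi C)) => eC /=.
  have CAe : flat_le F C (flat_add e A) by rewrite flat_add_le // CA.
  by rewrite hM // /sgn flat_rank_add // GRing.exprS GRing.mulN1r GRing.mulNr
    GRing.subrr GRing.mulr0.
rewrite big1 ?GRing.addr0 // => B /and3P[BF CB BAe].
have : flat_le F C (flat_add e A) by apply: flat_le_trans CB BAe.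
by rewrite flat_add_le // (negPf eC) andbF.
Qed.

Lemma deletion_contraction_moebius A : A \in flats F -> flat_le F A0 A ->
  N A (Gamma_flat F A :&: xi A0) =
  \sum_(B in flats F | flat_le F A0 B && flat_le F B A)
    `|moebius (flats F) (flat_le F) B A|%N.
Proof.
move=> AF A0A; have [g [gM <-]] := moebius_expansion AF A0A (subxx _).
apply: eq_bigr => B /and3P[BF A0B BA].
have sgnK C : (sgn C * sgn C = 1)%R by rewrite -GRing.expr2 GRing.sqrr_sign.
rewrite -(@moebius_unique _ _ _ _ _ _ (fun B => sgn A * (sgn B * (g B)%:R))%R) //.
- by rewrite /sgn !abszM !abszX abszN1 !exp1n !mul1n natz.
- exact: flat_le_refl.
- exact: flat_le_trans.
- exact: flat_le_anti.
move=> C CF BC CA; rewrite -GRing.mulr_sumr gM // GRing.mulrA sgnK GRing.mul1r.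
(* For [C] strictly below [A], [flat_lt_Gamma] provides an element of [Gamma A] in [xi C], and
   [xi C] lies in [xi A0]. *)
suff -> : [disjoint Gamma_flat F A :&: xi A0 & xi C] = (C == A) by [].
have [->|neCA] := eqVneq C A.
  rewrite disjoint_subset; apply/subsetP => e /setIP[eA _].
  exact: Gamma_xi eA.
have [e eA eC] := flat_lt_Gamma AF CF CA neCA.
have A0C : flat_le F A0 C by apply: flat_le_trans A0B BC.
apply/negbTE; rewrite disjoint_subset; apply/subsetPn; exists e; rewrite inE ?negbK //.
by rewrite eA; apply: subsetP eC; rewrite -flat_leE.
Qed.

End DeletionContraction.

End Greedoid.

(** * Covectors of an oriented interval greedoid *)

Section OrientedGreedoid.

Variables (E : finType) (F : {set {set E}}) (L : {set {ffun E -> symbol}}).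
Hypothesis og : oriented_interval_greedoid F L.

Implicit Types (S : {set E}) (A B C : {set {set E}}).
Implicit Types (a b c : {ffun E -> symbol}).

Let gF : interval_greedoid F := oig_greedoid og.

Lemma supp_covector a : a \in L ->
  supp F a \in flats F /\ covector_on F (supp F a) a.
Proof.
by move/(oig_covector og)/existsP=> [A /andP[AF aA]]; rewrite (suppE AF aA).
Qed.

Lemma supp_flat a : a \in L -> supp F a \in flats F.
Proof. by case/supp_covector. Qed.

Lemma signed_covector a e : a \in L ->
  signed (a e) = (e \in Gamma_flat F (supp F a)).
Proof.
case/supp_covector=> AF /forallP/(_ e); case: ifP => // _.
by case: ifP => _ /eqP->.
Qed.

Lemma zero_covector a e : a \in L -> (a e == SZero) = (e \in xi (supp F a)).
Proof.
move=> aL; have [AF /forallP/(_ e)] := supp_covector aL; case: ifP => [eA|_].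
  by rewrite (negPf (Gamma_xi AF eA)); case: (a e).
by case: ifP => _ /eqP->.
Qed.

Lemma covector_eq a b : a \in L -> b \in L -> supp F a = supp F b ->
  {in Gamma_flat F (supp F a), a =1 b} -> a = b.
Proof.
move=> aL bL eab eqG; apply/ffunP => e.
have [_ /forallP/(_ e)] := supp_covector aL.
have [_ /forallP/(_ e)] := supp_covector bL; rewrite -eab.
case: ifP => [eA _ _|_]; first exact: eqG.
by case: ifP => _ /eqP-> /eqP->.
Qed.

(** For comparable supports the join is [supp F b]. On its [Gamma], [a] is signed or zero by
    [Gamma_flat_lower], so comparing symbols amounts to letting the signs of [a] prevail. *)
Lemma cov_prod_covector a b : a \in L -> b \in L ->
    flat_le F (supp F a) (supp F b) ->
  [/\ cov_prod F a b \in L,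
      supp F (cov_prod F a b) = supp F b,
      forall e, e \in Gamma_flat F (supp F b) ->
        cov_prod F a b e = if signed (a e) then a e else b e &
      forall e, e \in xi (supp F b) -> cov_prod F a b e = SZero].
Proof.
move=> aL bL leab; have aF := supp_flat aL; have bF := supp_flat bL.
have sba : xi (supp F b) \subset xi (supp F a) by rewrite -(flat_leE gF).
have eqJ : join F (supp F a) (supp F b) = supp F b.
  by rewrite /join (setIidPr sba) (mu_xi gF).
have valG e : e \in Gamma_flat F (supp F b) ->
    cov_prod F a b e = if signed (a e) then a e else b e.
  move=> eb; rewrite ffunE eqJ in_setU eb /=.
  have := subsetP (Gamma_flat_lower gF bF aF leab) _ eb.
  rewrite in_setU -zero_covector // -signed_covector //.
  by have := eb; rewrite -signed_covector //; case: (a e); case: (b e).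
have valX e : e \in xi (supp F b) -> cov_prod F a b e = SZero.
  move=> eb; rewrite ffunE eqJ in_setU eb orbT.
  have := subsetP sba _ eb; rewrite -zero_covector // => /eqP->.
  by have := eb; rewrite -zero_covector // => /eqP->.
split=> //; first exact: oig_prod.
apply: suppE => //; apply/forallP => e; case: ifP => eG.
  rewrite valG //; have := eG; rewrite -signed_covector //.
  by case: ifP.
case: ifP => eX; first by rewrite valX.
by rewrite ffunE eqJ in_setU eG eX.
Qed.

Lemma cov_opp_covector a : a \in L ->
  cov_opp a \in L /\ supp F (cov_opp a) = supp F a.
Proof.
move=> aL; split; first by rewrite -(oig_opp og) imset_f.
have [AF aA] := supp_covector aL; apply: suppE => //; apply/forallP => e.
have := forallP aA e; rewrite ffunE; case: ifP => _; first by case: (a e).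
by case: ifP => _ /eqP->.
Qed.

(** (OG4) makes [c] vanish at [e], and also on [xi (supp F a)], where [a] and [b] are both zero and
    hence not separated; [flat_add_le] then bounds the support of [c]. *)
Lemma elimination a b e : a \in L -> b \in L -> supp F a = supp F b ->
    e \in separation a b ->
  exists2 c, c \in L &
    flat_le F (supp F c) (flat_add F e (supp F a)) /\
    forall y, y \in Gamma_flat F (supp F a) -> a y = b y -> c y = a y.
Proof.
move=> aL bL eab eS; have aF := supp_flat aL.
have [|_ _ abG abX] := cov_prod_covector aL bL; first by rewrite eab (flat_le_refl gF) -?eab.
have eG : e \in Gamma_flat F (supp F a).
  by rewrite -signed_covector //; move: eS; rewrite inE => /andP[].
have abGE y : y \in Gamma_flat F (supp F a) -> cov_prod F a b y = a y.
  by move=> yG; rewrite abG -?eab // signed_covector // yG.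
have nOne y : signed y -> y != SOne by case: y.
have [|c cL [ce cE]] := oig_elim og aL bL eS.
  by rewrite abGE // nOne // signed_covector.
exists c => //; split=> [|y yG eqy].
  rewrite (flat_add_le gF) // ?supp_flat // -zero_covector // ce eqxx andbT.
  rewrite (flat_leE gF) // ?supp_flat //; apply/subsetP => y yX.
  have [||cy _] := cE y; last by rewrite -zero_covector // cy abX // -eab.
    by rewrite inE; move: yX; rewrite -zero_covector // => /eqP->.
  by rewrite abX // -eab.
have [||-> _] := cE y; last exact: abGE.
  by rewrite inE -eqy; case: (a y).
by rewrite abGE // nOne // signed_covector.
Qed.

(** * Counting the covectors above a fixed covector *)

Section Above.

Variable a : {ffun E -> symbol}.
Hypothesis aL : a \in L.

Definition above A : {set {ffun E -> symbol}} :=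
  [set b in L | (supp F b == A) && cov_le F a b].

Lemma aboveP A b : flat_le F (supp F a) A ->
  reflect [/\ b \in L, supp F b = A &
            {in Gamma_flat F (supp F a) :&: Gamma_flat F A, a =1 b}]
          (b \in above A).
Proof.
move=> leA; rewrite inE; apply: (iffP and3P) => [[bL /eqP bA /andP[_]]|[bL bA ab]].
  by rewrite bA => /forall_inP ab; split=> // e /ab/eqP.
split; rewrite ?bA //; apply/andP; split; rewrite bA //.
by apply/forall_inP => e /ab->.
Qed.

(** Left multiplication by [a] imposes the signs of [a] and changes nothing on [Gamma A] where [a]
    vanishes. So, for restrictions to such points, any covector of support [A] may be assumed to lie
    above [a]. *)
Lemma cov_prod_above A b : b \in L -> supp F b = A -> flat_le F (supp F a) A ->
  cov_prod F a b \in above A /\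
  {in Gamma_flat F A :&: xi (supp F a), cov_prod F a b =1 b}.
Proof.
move=> bL bA leA; have [|abL] := cov_prod_covector aL bL; rewrite bA // => abS abG _.
split=> [|e /setIP[eA]]; last first.
  by rewrite -zero_covector // abG // => /eqP->.
apply/aboveP => //; split=> // e /setIP[ea eA].
by rewrite abG // signed_covector // ea.
Qed.

(** Padding with [SZero] keeps the restrictions to all sets [S] in one finite type. *)
Definition restr S b : {ffun E -> symbol} :=
  [ffun e => if e \in S then b e else SZero].

Lemma eq_restr S b c : (restr S b = restr S c) <-> {in S, b =1 c}.
Proof.
split=> [/ffunP eqbc e eS|eqbc]; first by have := eqbc e; rewrite !ffunE eS.
by apply/ffunP => e; rewrite !ffunE; case: ifP => // /eqbc.
Qed.

Definition restr_count A S : nat := #|restr S @: above A|.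

Lemma restr_count0 A : A \in flats F -> flat_le F (supp F a) A ->
  restr_count A set0 = 1.
Proof.
move=> AF leA; have [b bL bA] := oig_surj og AF.
have [abA _] := cov_prod_above bL bA leA.
apply/eqP/cards1P; exists (restr set0 a); apply/eqP; rewrite eqEsubset.
apply/andP; split; last first.
  rewrite sub1set; apply/imsetP; exists (cov_prod F a b) => //.
  by apply/eq_restr => e; rewrite inE.
apply/subsetP => _ /imsetP[c _ ->]; rewrite inE; apply/eqP/eq_restr => e.
by rewrite inE.
Qed.

(** The restrictions to [S] that extend to [e |: S] with symbol [s] at [e]. *)
Let half A S e s := restr S @: [set b in above A | b e == s].

Let in_side A e s b :
  (b \in [set c in above A | c e == s]) = (b \in above A) && (b e == s).
Proof. by rewrite inE. Qed.

(** Once the sign at [e] is fixed, a restriction to [e |: S] is determined by its values on [S]. The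
    sizes of the two halves add up to those of their union, which is all restrictions to [S], and
    their intersection. *)
Lemma restr_countU1_halves A S e : A \in flats F -> flat_le F (supp F a) A ->
  e \in Gamma_flat F A -> e \notin S ->
  restr_count A (e |: S) =
    restr_count A S + #|half A S e SPlus :&: half A S e SMinus|.
Proof.
move=> AF leA eA eS.
have aboveU : above A = [set b in above A | b e == SPlus] :|:
                        [set b in above A | b e == SMinus].
  apply/setP => b; rewrite in_setU.
  rewrite !in_side -andb_orr; apply/esym/andb_idr => /(aboveP _ leA)[bL bA _].
  by have := signed_covector e bL; rewrite bA eA; case: (b e).
have cardH s : #|restr (e |: S) @: [set b in above A | b e == s]| = #|half A S e s|.
  have -> : half A S e s =
      restr S @: (restr (e |: S) @: [set b in above A | b e == s]).
    rewrite -imset_comp; apply: eq_imset => b /=.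
    by apply/eq_restr => t tS; rewrite !ffunE in_setU1 tS orbT.
  rewrite [RHS]card_in_imset // => _ _ /imsetP[b + ->] /imsetP[c + ->].
  rewrite !in_side => /andP[_ /eqP be] /andP[_ /eqP ce].
  move/eq_restr => eqbc; apply/eq_restr => t; rewrite in_setU1 => /predU1P[->|tS].
    by rewrite be ce.
  by have := eqbc t tS; rewrite !ffunE in_setU1 tS orbT.
rewrite /restr_count {1 2}aboveU !imsetU cardsUI -!cardH -cardsUI.
rewrite [X in _ + X](_ : _ = 0) ?addn0 //; apply/eqP; rewrite cards_eq0.
apply/set0Pn => -[_ /setIP[/imsetP[b + ->] /imsetP[c + ]]].
rewrite !in_side => /andP[_ /eqP be] /andP[_ /eqP ce] /eq_restr/(_ e (setU11 _ _)).
by rewrite be ce.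
Qed.

Lemma halves_elimination A S e : A \in flats F -> flat_le F (supp F a) A ->
  e \in Gamma_flat F A -> S \subset Gamma_flat F A ->
  forall r, r \in half A S e SPlus :&: half A S e SMinus ->
  exists c, [/\ c \in L, flat_le F (supp F c) (flat_add F e A) & r = restr S c].
Proof.
move=> AF leA eA SA r /setIP[/imsetP[b + ->] /imsetP[c + /eq_restr eqbc]].
rewrite !in_side => /andP[/(aboveP _ leA)[bL bA _] /eqP be].
case/andP=> /(aboveP _ leA)[cL cA _] /eqP ce.
have [||d dL [dA dE]] := elimination bL cL (e := e); first by rewrite bA.
  by rewrite inE be ce.
rewrite bA in dA dE; exists d; split=> //; apply/eq_restr => t tS.
by rewrite dE ?eqbc // (subsetP SA).
Qed.

(** A common restriction would come both from a covector of support [A], signed on all of [S], and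
    from one of support below [A + e], zero where [S] meets [xi (A + e)]. *)
Lemma halves_disjoint A S e : A \in flats F -> flat_le F (supp F a) A ->
  e \in Gamma_flat F A -> S \subset Gamma_flat F A ->
  ~~ [disjoint S & xi (flat_add F e A)] ->
  half A S e SPlus :&: half A S e SMinus = set0.
Proof.
move=> AF leA eA SA /pred0Pn[s /andP[/= sS sX]]; apply/eqP/set0Pn => -[r rH].
have [c [cL leC rc]] := halves_elimination AF leA eA SA rH.
have [/imsetP[b + rb] _] := setIP rH; rewrite in_side.
case/andP=> /(aboveP _ leA)[bL bA _] _.
have addF := flat_add_flat gF AF eA; have cF := supp_flat cL.
have /eqP c0 : c s == SZero.
  by rewrite zero_covector //; apply: subsetP sX; rewrite -(flat_leE gF).
have : signed (b s) by rewrite signed_covector // bA (subsetP SA).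
by move/eq_restr: (etrans (esym rb) rc) => -> //; rewrite c0.
Qed.

Lemma halves_contraction A S e : A \in flats F -> flat_le F (supp F a) A ->
  S \subset Gamma_flat F A :&: xi (supp F a) ->
  e \in Gamma_flat F A :&: xi (supp F a) ->
  [disjoint S & xi (flat_add F e A)] ->
  half A S e SPlus :&: half A S e SMinus = restr S @: above (flat_add F e A).
Proof.
move=> AF leA SAa /setIP[eA ea] dS; have [SA Sa] := subsetIP SAa.
have aF := supp_flat aL; have addF := flat_add_flat gF AF eA.
have leAe : flat_le F (supp F a) (flat_add F e A) by rewrite (flat_add_le gF) // leA.
have leAeA := flat_add_le_self gF AF eA.
have SAe : S \subset Gamma_flat F (flat_add F e A).
  apply/subsetP => s sS; have sA := subsetP SA _ sS.
  have := subsetP (Gamma_flat_lower gF AF addF leAeA) _ sA.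
  by rewrite in_setU (disjointFr dS sS) orbF.
apply/eqP; rewrite eqEsubset; apply/andP; split; apply/subsetP => r.
  move=> rH; have [c [cL leC rc]] := halves_elimination AF leA eA SA rH.
  (* The support of [c] may be strictly below [A + e], and [c] need not be above [a]. The products
     with [d] and then with [a] repair both without changing values on [S]. *)
  have [d dL dA] := oig_surj og addF.
  have [|cdL] := cov_prod_covector cL dL; rewrite dA // => cdA cdG _.
  have [ab aE] := cov_prod_above cdL cdA leAe.
  apply/imsetP; exists (cov_prod F a (cov_prod F c d)) => //; rewrite rc.
  have [/imsetP[b + rb] _] := setIP rH; rewrite in_side.
case/andP=> /(aboveP _ leA)[bL bA _] _.
  apply/eq_restr => t tS; have /eq_restr eqcb := etrans (esym rc) rb.
  rewrite aE ?inE ?(subsetP SAe) ?(subsetP Sa) // cdG ?(subsetP SAe) //.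
  by rewrite eqcb // signed_covector // bA (subsetP SA).
case/imsetP=> c /(aboveP _ leAe)[cL cA ac] ->.
have inhalf s : signed s -> restr S c \in half A S e s.
  (* A covector of support [A] or its opposite has sign [s] at [e]. Its product with [c] on the left
     keeps that sign, as [c] is zero at [e], and takes the values of [c] on [S]. *)
  move=> ss; have [b bL [bA be]] : exists2 b, b \in L & supp F b = A /\ b e = s.
    have [b bL bA] := oig_surj og AF.
    have [bs|nbs] := eqVneq (b e) s; first by exists b.
    have [obL obA] := cov_opp_covector bL; exists (cov_opp b); rewrite // obA bA.
    have := signed_covector e bL; rewrite bA eA ffunE => bs; split=> //.
    by move: bs ss nbs; case: (b e); case: (s).
  have [|cbL] := cov_prod_covector cL bL; rewrite ?cA ?bA // => cbA cbG _.
  apply/imsetP; exists (cov_prod F c b).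
    rewrite in_side; apply/andP; split; last first.
      rewrite cbG // signed_covector // cA be.
      by case: ifP => // /(Gamma_xi addF); rewrite mem_xi_flat_add.
    apply/aboveP => //; split=> // t /setIP[ta tA].
    rewrite cbG //.
    (* Otherwise [t] would be in [xi (A + e)], hence in [xi (supp F a)], although [a] is signed at
       [t]. *)
    have tc : t \in Gamma_flat F (supp F c).
      have := subsetP (Gamma_flat_lower gF AF addF leAeA) _ tA.
      rewrite cA in_setU => /orP[//|tX].
      have := Gamma_xi aF ta; case/negP; apply: subsetP tX.
      by rewrite -(flat_leE gF).
    by rewrite signed_covector // tc; apply: ac; rewrite inE ta -cA.
  apply/eq_restr => t tS; rewrite cbG ?(subsetP SA) //.
  by rewrite signed_covector // cA (subsetP SAe).
by rewrite inE !inhalf.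
Qed.

(** Restriction to [Gamma A :&: xi (supp F a)] loses nothing: the other points of [Gamma A] are in
    [Gamma (supp F a)], where [a] prescribes the sign. The lemmas on halves give the recursion for
    [restr_count]. *)
Lemma card_above A : A \in flats F -> flat_le F (supp F a) A ->
  #|above A| = \sum_(B in flats F | flat_le F (supp F a) B && flat_le F B A)
    `|moebius (flats F) (flat_le F) B A|%N.
Proof.
move=> AF leA; have aF := supp_flat aL.
rewrite -(deletion_contraction_moebius gF aF (N := restr_count)) //.
- rewrite /restr_count card_in_imset // => b c /(aboveP _ leA)[bL bA ab].
  case/(aboveP _ leA)=> cL cA ac /eq_restr eqbc.
  apply: covector_eq => //; first by rewrite bA.
  rewrite bA => e eA; have := subsetP (Gamma_flat_lower gF AF aF leA) _ eA.
  rewrite in_setU => /orP[ea|ea]; last by rewrite eqbc // inE eA.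
  by rewrite -ab ?inE ?ea // ac // inE ea.
- by move=> B BF leB; apply: restr_count0.
move=> B S e BF leB SB eB eS; have [eGB _] := setIP eB.
rewrite restr_countU1_halves //; congr addn.
case: (boolP [disjoint _ & _]) => dS; first by rewrite mul1n halves_contraction.
rewrite halves_disjoint ?cards0 //; exact: subset_trans SB (subsetIl _ _).
Qed.

End Above.

(** * Chains of covectors *)

(** There is no sign to choose: an [e] in [Gamma A] would give a flat [A + e] that is not above
    [A]. *)
Lemma bottom_covector_unique A a b : A \in flats F ->
  (forall B, B \in flats F -> flat_le F A B) ->
  a \in L -> b \in L -> supp F a = A -> supp F b = A -> a = b.
Proof.
move=> AF botA aL bL aA bA; apply: covector_eq => // [|e]; rewrite aA // => eA.
have := botA _ (flat_add_flat gF AF eA).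
by rewrite (flat_add_le gF) // (negPf (Gamma_xi AF eA)) andbF.
Qed.

Definition moebius_abs_sum C B : nat :=
  \sum_(D in flats F | flat_le F C D && flat_le F D B)
    `|moebius (flats F) (flat_le F) D B|%N.

Definition chains_over k (A : k.-tuple {set {set E}}) :
    {set k.-tuple {ffun E -> symbol}} :=
  [set a : k.-tuple _ |
    [&& all (mem L) a, sorted (cov_gt F) a & map (supp F) a == A]].

(** Induction removing the top covector: the rest is a chain over the shorter tuple, and by
    [card_above] the number of choices for the top depends only on the supports. *)
Lemma card_chains_over k (A : k.+1.-tuple {set {set E}}) :
  all (mem (flats F)) A -> sorted (flat_gt F) A ->
  (forall B, B \in flats F -> flat_le F (last set0 A) B) ->
  #|chains_over A| =
    \prod_(i < k) moebius_abs_sum (nth set0 A i.+1) (nth set0 A i).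
Proof.
elim: k A => [|k IH] A.
  case/tupleP: A => A0 A'; rewrite (tuple0 A') /= andbT => AF _ botA.
  rewrite big_ord0; have [a aL aA] := oig_surj og AF.
  apply/eqP/cards1P; exists [tuple a]; apply/setP => b; rewrite !inE.
  case/tupleP: b => b b'; rewrite (tuple0 b') /= !andbT.
  apply/andP/eqP => [[bL /eqP[bA]]|[->]]; last by rewrite aL aA.
  by congr [tuple _]; apply: (bottom_covector_unique AF).
case/tupleP: A => A0 A; case/tupleP: A => A1 A.
set A1s := [tuple of A1 :: A].
rewrite [all _ _]/= [sorted _ _]/= => /andP[A0F A1sF] /andP[gtA pA] botA.
have [A1F _] := andP A1sF.
rewrite big_ord_recl /= -[X in _ * X](IH A1s A1sF pA botA).
have [leA neA] := andP gtA.
have chains_cons b (c : k.+1.-tuple _) :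
    (cons_tuple b c \in chains_over [tuple of A0 :: A1s]) =
    (c \in chains_over A1s) && (b \in above (thead c) A0).
  case/tupleP: c => c0 c; rewrite theadE !inE /= !eqseq_cons /cov_gt.
  have [bA|] := eqVneq (supp F b) A0; last by rewrite !andbF.
  have [c0A|] := eqVneq (supp F c0) A1; last by rewrite !andbF.
  (* Strictness is automatic because the supports differ. *)
  have -> : c0 != b by apply: contraNneq neA => eqcb; rewrite -c0A -bA eqcb.
  by case: (b \in L); case: (c0 \in L); case: (cov_le F c0 b);
    rewrite /= ?andbT ?andbF.
pose tl (t : k.+2.-tuple {ffun E -> symbol}) : k.+1.-tuple _ := behead_tuple t.
have tlE b (d : k.+1.-tuple _) : tl (cons_tuple b d) = d by apply: val_inj.
have consP (t : k.+2.-tuple {ffun E -> symbol}) :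
    exists b (d : k.+1.-tuple _), t = cons_tuple b d.
  by case/tupleP: t => b d; exists b, d.
(* The chains are grouped by their tail [c]; the fibre over [c] is in bijection with
   [above (thead c) A0]. *)
rewrite -[LHS]sum1_card (partition_big tl (mem (chains_over A1s))); last first.
  by move=> t; have [b [c ->]] := consP t; rewrite chains_cons tlE => /andP[].
rewrite mulnC -sum_nat_const; apply: eq_bigr => c cC.
have {}cC : c \in chains_over A1s by [].
transitivity #|above (thead c) A0|; last first.
  case/tupleP: c cC => c0 c; rewrite theadE inE /= eqseq_cons -!andbA.
  case/and4P=> c0L _ _ /andP[/eqP c0A _].
  by rewrite (card_above c0L) // c0A.
have cons_inj : injective (fun b => cons_tuple b c).
  by move=> b b' /(congr1 val)[].
rewrite sum1dep_card -(card_imset _ cons_inj); apply: eq_card => t.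
have [b [d ->]] := consP t; rewrite inE chains_cons tlE.
apply/idP/imsetP => [/andP[/andP[_ bd] /eqP <-]|]; first by exists b.
by case=> b' b'c /(congr1 val)[-> /val_inj->]; rewrite eqxx b'c cC.
Qed.

End OrientedGreedoid.

(** Tuples are indexed from 0, so [nth set0 A i] is the flat numbered [i + 1] in the chain; that the
    last one is the bottom is expressed by its lying below every flat. *)
Theorem mainTheorem3 (E : finType) (F : {set {set E}})
    (L : {set {ffun E -> symbol}}) (k : nat) (A : k.+1.-tuple {set {set E}}) :
  oriented_interval_greedoid F L ->
  (forall i : 'I_k.+1, tnth A i \in flats F) ->
  sorted (flat_gt F) A ->
  (forall B, B \in flats F -> flat_le F (tnth A ord_max) B) ->
  #|[set a : k.+1.-tuple {ffun E -> symbol} |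
       [&& [forall i, tnth a i \in L],
           sorted (cov_gt F) a &
           [forall i, supp F (tnth a i) == tnth A i]]]| =
  \prod_(i < k)
    \sum_(B in flats F | flat_le F (nth set0 A i.+1) B &&
                         flat_le F B (nth set0 A i))
      `|moebius (flats F) (flat_le F) B (nth set0 A i)|%N.
Proof.
move=> og AF sA botA.
rewrite -(card_chains_over og) //; last 2 first.
- by apply/all_tnthP.
- by move=> B /botA; rewrite (tnth_nth set0) -nth_last size_tuple.
apply: eq_card => a; rewrite !inE; congr [&& _, _ & _].
  by apply/forallP/all_tnthP.
apply/forallP/eqP => [eqA|eqA i].
  have -> : map (supp F) a = map_tuple (supp F) a by [].
  by congr val; apply: eq_from_tnth => i; rewrite tnth_map; apply/eqP.
have <- : map_tuple (supp F) a = A by apply: val_inj.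
by rewrite tnth_map.
Qed.
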